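(* Let $G$ be a finite group and $p$ a prime, and let $\mathbf 1_G$ denote the trivial $\mathbb{Z}_p[G]$-lattice $\mathbb{Z}_p$. Then $v_p(C_{\theta_G}(\mathbf 1_G))\neq0$ if and only if $G$ contains a non-cyclic $p$-hypo-elementary subgroup. Moreover, if $G$ contains a non-cyclic $p$-hypo-elementary subgroup, then $v_p(C_{\theta_G}(\mathbf 1_G))\le -p/|G|$.
   Context: A finite group is $p$-hypo-elementary if it has a normal Sylow $p$-subgroup with cyclic quotient. Burnside ring: $b(G)$ is the free abelian group on the symbols $[H]$ ($H$ up to conjugacy, $[H]$ standing for $G/H$), and $B(G)=b(G)\otimes\mathbb{Q}$. Artin relation: there are unique $\alpha_H\in\mathbb{Q}$, for $H$ running over representatives of conjugacy classes of cyclic subgroups, with $[\mathbf 1]=\sum_H\alpha_H[\mathbb{Q}[G/H]]$ in $A(\mathbb{Q}[G])$ (rational representation ring tensored with $\mathbb{Q}$). The Artin relation is $\theta_G=[G]-\sum_H\alpha_H[H]\in B(G)$; it lies in the kernel of $[H]\mapsto[\mathbb{Q}[G/H]]$. Regulator constants: for an integral relation $\theta=\sum_i[H_i]-\sum_j[H'_j]$ and a $\mathbb{Z}_p[G]$-lattice $M$ with non-degenerate $G$-invariant symmetric $\mathbb{Q}_p$-valued form $\langle\ ,\ \rangle$, set $$C_\theta(M)=\frac{\prod_i\det\big(\tfrac{1}{|H_i|}\langle\ ,\ \rangle|_{M^{H_i}}\big)}{\prod_j\det\big(\tfrac{1}{|H'_j|}\langle\ ,\ \rangle|_{M^{H'_j}}\big)}\in\mathbb{Q}_p^\times/(\mathbb{Z}_p^\times)^2,$$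 using Gram determinants with respect to $\mathbb{Z}_p$-bases; the value is independent of the form. For a rational relation $\theta$, $v_p(C_\theta(M))=\frac1n v_p(C_{n\theta}(M))$ with $n\theta$ integral. For $\mathbf 1_G$ with form $\langle x,y\rangle=xy$ this gives $v_p(C_\theta(\mathbf 1_G))=\sum_j v_p(|H'_j|)-\sum_i v_p(|H_i|)$, extended linearly. *)

(* Defs.v *)
From HB Require Import structures.
From mathcomp Require Import all_boot all_order all_algebra all_fingroup all_solvable all_field all_character.
Set Implicit Arguments. Unset Strict Implicit. Unset Printing Implicit Defensive.
Import Order.TTheory GRing.Theory Num.Theory.
Local Open Scope ring_scope.

Definition p_hypo_elementary (gT : finGroupType) (p : nat) (H : {group gT}) : Prop :=
  exists P : {group gT}, [/\ P \in Syl p H, (P <| H)%g & cyclic (H / P)%g].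

Definition cyclic_class_reps (gT : finGroupType) (G : {group gT})
    (R : {set {group gT}}) : Prop :=
  [/\ (forall K : {group gT}, K \in R -> K \subset G /\ cyclic K),
      (forall H : {group gT}, H \subset G -> cyclic H ->
         exists2 K : {group gT}, K \in R & exists2 x, x \in G & (H :=: K :^ x)%g)
    & (forall K1 K2 : {group gT}, K1 \in R -> K2 \in R ->
         (exists2 x, x \in G & (K1 :=: K2 :^ x)%g) -> K1 = K2)].

(* The alpha_H give the Artin relation: in the rational representation ring
   (detected by characters), [1] = sum_H alpha_H [Q[G/H]], where the character of
   Q[G/H] is the permutation character 'Ind[G, H] 1. *)
Definition artin_coeffs (gT : finGroupType) (G : {group gT})
    (R : {set {group gT}}) (alpha : {group gT} -> rat) : Prop :=
  (1 : 'CF(G)) = \sum_(H in R) (ratr (alpha H) : algC) *: 'Ind[G, H] (1 : 'CF(H)).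

(* An element of B(G) = b(G) (x) Q, written as a formal Q-combination sum c [H]. *)
Definition burnside_elt (gT : finGroupType) := seq (rat * {group gT}).

Definition artin_relation (gT : finGroupType) (G : {group gT})
    (R : {set {group gT}}) (alpha : {group gT} -> rat) : burnside_elt gT :=
  (1, G) :: [seq (- alpha H, H) | H <- enum R].

(* v_p(C_theta(1_G)) for the trivial lattice with form <x,y> = xy:
   sum over theta = sum c_H [H] of  - c_H * v_p(|H|)  (extended linearly). *)
Definition vp_regconst_trivial (gT : finGroupType) (p : nat)
    (theta : burnside_elt gT) : rat :=
  \sum_(t <- theta) - t.1 * (logn p #|t.2|)%:R.

(* Main.v *)
(* Let h(x) = v_p(o(x)) + [p | o(x)] / (p - 1).  On a cyclic group C the mean of h
   is v_p(|C|), so pairing the Artin relation with the class function h gives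
   |G| v = \sum_(x in G) h(x) - |G| v_p(|G|), without computing the alpha_H.
   The sum of h only depends on the numbers L_i of solutions of x ^ (m p^i) = 1,
   where m is the p'-part of |G|; Frobenius' theorem says m p^i | L_i, whence v <= 0.
   If a Sylow p-subgroup P is cyclic and central in its normalizer, the transfer
   G -> P gives L_i = m p^i, hence v = 0, and every p-hypo-elementary subgroup is
   cyclic by fusion.  Otherwise P, or P<x> with x in N(P) not centralizing P, is a
   non-cyclic p-hypo-elementary subgroup, and counting the elements whose p-part
   generates a Sylow subgroup makes the last L_i exceed |G| / p by at least p - 1. *)
Require Import Defs.
From HB Require Import structures.
From mathcomp Require Import all_boot all_order all_algebra all_fingroup all_solvable all_field all_character.
From mathcomp Require Import zify ring lra.
Set Implicit Arguments. Unset Strict Implicit.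
Import FiniteModule Order.TTheory GRing.Theory Num.Theory.

(** * Fusion and transfer for a Sylow subgroup central in its normalizer *)

Section SylowCentralInNormalizer.

Local Open Scope group_scope.

Variables (gT : finGroupType) (p : nat) (G P : {group gT}).
Hypotheses (sylP : p.-Sylow(G) P) (abP : abelian P) (cNP : 'N_G(P) \subset 'C(P)).

(** Burnside's argument: [P] and [P :^ x^-1] are Sylow in ['C_G(Q)], hence conjugate there by some
    [c]; then [c * x] normalizes [P], so it centralizes [Q], and so does [x]. *)
Lemma central_Sylow_fusion (Q : {group gT}) (x : gT) :
  Q \subset P -> x \in G -> Q :^ x \subset P -> x \in 'C(Q).
Proof.
move=> sQP Gx sQxP; have sPG := pHall_sub sylP.
have sPC : P \subset 'C_G(Q).
  by rewrite subsetI sPG; apply: subset_trans abP (centS _).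
have sPxC : P :^ x^-1 \subset 'C_G(Q).
  rewrite subsetI conj_subG ?groupV //= sub_conjgV -centJ.
  exact: subset_trans abP (centS _).
have sylC (S : {group gT}) : p.-Sylow(G) S -> S \subset 'C_G(Q) ->
    p.-Sylow('C_G(Q)) S.
  by move=> sylS sSC; apply: pHall_subl sSC (subsetIl _ _) sylS.
have sylPx : p.-Sylow(G) (P :^ x^-1)%G by rewrite pHallJ ?groupV.
have [c /setIP[Gc Cc] defPx] := Sylow_trans (sylC _ sylP sPC) (sylC _ sylPx sPxC).
have Ncx : c * x \in 'N_G(P).
  by rewrite inE groupM //=; apply/normP; rewrite conjsgM -defPx /= conjsgKV.
have Ccx : c * x \in 'C(Q) by apply: subsetP (subset_trans cNP (centS sQP)) _ Ncx.
by rewrite -(mulKg c x) groupM ?groupV.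
Qed.

(* The transfer G -> P: by fusion control each of its factors at x in P is a
   plain power of x. *)
Lemma transfer_central_Sylow :
  exists2 f : {morphism G >-> gT},
    f @* G \subset P & {in P, forall x, f x = x ^+ #|G : P|}.
Proof.
have sPG := pHall_sub sylP.
have abA : abelian (idm P @* P) by rewrite morphim_idm.
pose f x := val (transfer G abA x).
have fM : {in G &, {morph f : x y / x * y}}.
  by move=> x y Gx Gy; rewrite /f transferM.
exists (Morphism fM) => /=.
  apply/subsetP=> _ /morphimP[x _ Gx ->] /=.
  have sAP : idm P @* P \subset P by rewrite morphim_idm.
  exact: subsetP sAP _ (fmodP (transfer G abA x)).
move=> x Px; have Gx := subsetP sPG x Px.
have trX := transversalP (rcosets_cycle_partition sPG Gx).
set X := transversal _ _ in trX.
rewrite /f (transfer_cycle_expansion sPG abA Gx trX) -(sum_index_rcosets_cycle sPG Gx trX).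
have sXG := subsetP (transversal_sub trX).
(* The exponents, the cycle lengths of [x] on the cosets of [P], add up to the index once the
   conjugations by [y^-1] are removed. *)
suffices E y : y \in X -> (x ^+ #|<[x]> : P :* y|) ^ y^-1 = x ^+ #|<[x]> : P :* y|.
  rewrite (big_morph _ (@fmvalA _ _ abA) (@fmval0 _ _ abA)).
  elim/big_rec2: _ => //= y n z Xy ->.
  rewrite E // expgD; congr (_ * _).
  by rewrite /restrm /= fmodK ?mem_morphim ?groupX.
move=> Xy; set z := x ^+ _.
have Pz : z \in P by rewrite groupX.
have Pzy : z ^ y^-1 \in P.
  have := mulg_exp_card_rcosets P x y; rewrite mem_rcoset.
  by rewrite conjgE invgK mulgA.
rewrite conjgE invgK.
have /centP Cy : y^-1 \in 'C(<[z]>).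
  apply: central_Sylow_fusion; rewrite ?cycle_subG ?groupV ?sXG //.
  by rewrite -cycleJ cycle_subG.
by rewrite -{1}(invgK y) -(Cy z (cycle_id z)) mulKg.
Qed.

(** On [P] the transfer is an injective power map, so its kernel is a [p']-group. Solutions map to
    solutions of [z ^+ n = 1] in the cyclic image, which has at most [n] of them. *)
Lemma card_Ldiv_central_Sylow (n : nat) : cyclic P -> 0 < n ->
  #|'Ldiv_(#|G|`_p^' * n)(G)| <= #|G|`_p^' * n.
Proof.
move=> cycP n_gt0; have [sPG pP p'i] := and3P sylP.
have [f sfGP fP] := transfer_central_Sylow.
have co_i : coprime #|P| #|G : P|.
  exact: pnat_coprime pP p'i.
have tiKP : 'ker f :&: P = 1.
  apply/trivgP/subsetP=> x /setIP[/mker fx1 Px]; rewrite inE -(expgK co_i Px).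
  by rewrite -fP // fx1 expg1n.
have le_kerf : #|'ker f| <= #|G|`_p^'.
  apply: dvdn_leq; first exact: part_gt0.
  have p'K : p^'.-group ('ker f).
    have sylK : p.-Sylow('ker f) ('ker f :&: P).
      exact: Sylow_setI_normal (ker_normal f) sylP.
    by rewrite /pgroup -partn_eq1 ?cardG_gt0 // -(card_Hall sylK) /= tiKP cards1.
  by rewrite -(part_pnat_id p'K) partn_dvd ?cardG_gt0 // cardSg ?(normal_sub (ker_normal f)).
have cycfG : cyclic (f @* G) by apply: cyclicS sfGP cycP.
pose L := Group (group_Ldiv n (cyclic_abelian cycfG)).
have sLfG : L \subset f @* G by apply: subsetIl.
have le_L : #|L| <= n.
  have /cyclicP[y defL] := cyclicS sLfG cycfG.
  have /LdivP[_ yn1] : y \in 'Ldiv_n(f @* G).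
    by change (y \in L); rewrite defL cycle_id.
  by rewrite defL -orderE dvdn_leq // order_dvdn yn1.
apply: leq_trans (leq_mul le_kerf le_L); rewrite -(card_morphpre sLfG).
apply/subset_leq_card/subsetP=> x /LdivP[Gx xmn1].
rewrite mem_morphpre //; apply/LdivP; split; first exact: mem_morphim.
have Pfx : f x \in P by rewrite (subsetP sfGP) ?mem_morphim.
apply/eqP; rewrite -order_dvdn.
have co_m : coprime #[f x] #|G|`_p^'.
  exact: pnat_coprime (mem_p_elt pP Pfx) (part_pnat _ _).
by rewrite -(Gauss_dvdr _ co_m) order_dvdn -morphX // xmn1 morph1.
Qed.

(** Once [Q] is conjugated into [P], fusion forces [H] to centralize [Q]. A Schur-Zassenhaus
    complement is isomorphic to [H / Q], so [H] is a product of commuting cyclic groups of coprime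
    orders. *)
Lemma central_Sylow_hypo_elementary (H : {group gT}) : cyclic P ->
  H \subset G -> p_hypo_elementary p H -> cyclic H.
Proof.
move=> cycP sHG [Q []]; rewrite inE => sylQ nsQH.
have [sQH pQ p'i] := and3P sylQ; have nQH := normal_norm nsQH.
have [x Gx sQxP] : exists2 x, x \in G & Q :^ x \subset P.
  have [x Gx sQPx] := Sylow_subJ sylP (subset_trans sQH sHG) pQ.
  by exists x^-1; rewrite ?groupV // sub_conjgV.
have cycQ : cyclic Q by rewrite -(cyclicJ _ x); apply: cyclicS sQxP cycP.
have cQH : H \subset 'C(Q).
  apply/subsetP=> y Hy; have Gy := subsetP sHG y Hy.
  have : y ^ x \in 'C(Q :^ x).
    apply: central_Sylow_fusion (groupJ Gy Gx) _ => //.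
    by rewrite -conjsgM conjgE mulKVg conjsgM (normsP nQH).
  by rewrite centJ memJ_conjg.
have /splitsP[K /complP[tiQK defH]] : [splits H, over Q].
  by apply: SchurZassenhaus_split (pHall_Hall sylQ) nsQH.
move=> cycHQ; have sKH : K \subset H by rewrite -defH mulG_subr.
rewrite -defH; apply: cyclicM cycQ _ _ _.
- have [_ /isog_cyclic->] := (I, quotient_isog (subset_trans sKH nQH) tiQK).
  exact: cyclicS (quotientS _ sKH) cycHQ.
- exact: subset_trans sKH cQH.
apply: pnat_coprime pQ _.
have -> : #|K| = #|H : Q|.
  by rewrite -divgS // -defH TI_cardMg // mulKn ?cardG_gt0.
exact: p'i.
Qed.

End SylowCentralInNormalizer.

(** * Counting elements by the p-part of their order *)

Section Counting.

Local Open Scope group_scope.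
Local Open Scope nat_scope.

Variables (gT : finGroupType) (p : nat).
Hypothesis p_pr : prime p.
Implicit Types G H P : {group gT}.

Lemma noncyclic_hypo_elementary_exists G P : p.-Sylow(G) P ->
    ~~ (cyclic P && ('N_G(P) \subset 'C(P))) ->
  exists2 H : {group gT}, H \subset G & p_hypo_elementary p H /\ ~~ cyclic H.
Proof.
move=> sylP; have [sPG pP _] := and3P sylP.
have [cycP | ncycP _] := boolP (cyclic P); last first.
  exists P => //; split=> //; exists P; rewrite normal_refl; split=> //.
    by rewrite inE (pHall_subl (subxx _) sPG sylP).
  by rewrite trivg_quotient cyclic1.
case/subsetPn=> x /setIP[Gx nPx] notCx.
have sxN : <[x]>%g \subset 'N(P) by rewrite cycle_subG.
have sHG : (P <*> <[x]>)%g \subset G by rewrite join_subG sPG cycle_subG.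
exists (P <*> <[x]>)%G => //; split; last first.
  apply: contra notCx => /cyclic_abelian abH.
  have xH : x \in (P <*> <[x]>)%g by rewrite mem_gen // inE cycle_id orbT.
  exact: subsetP (subset_trans abH (centS (joing_subl _ _))) x xH.
exists P; rewrite inE (pHall_subl (joing_subl _ _) sHG sylP) normalYl sxN.
by rewrite /= quotientYidl // quotient_cyclic ?cycle_cyclic.
Qed.

Lemma mem_Ldiv_logn G i x :
  (x \in 'Ldiv_(#|G|`_p^' * p ^ i)(G)) = (x \in G) && (logn p #[x] <= i).
Proof.
apply/LdivP/andP=> [[Gx /eqP xn1] | [Gx le_xi]]; split=> //.
  rewrite -order_dvdn in xn1; have m_gt0 : 0 < #|G|`_p^' := part_gt0 _ _.
  have p_gt0 : 0 < p ^ i by rewrite expn_gt0 prime_gt0.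
  have co_m : coprime p #|G|`_p^'.
    by rewrite prime_coprime // -p'natE // part_pnat.
  have := dvdn_leq_log p _ xn1; rewrite muln_gt0 m_gt0 p_gt0 => /(_ isT).
  by rewrite lognM // (logn_coprime co_m) pfactorK.
apply/eqP; rewrite -order_dvdn -(partnC p (order_gt0 x)) mulnC dvdn_mul //.
  by rewrite partn_dvd ?cardG_gt0 // order_dvdG.
by rewrite p_part dvdn_exp2l.
Qed.

Lemma logn_card_gt0 G : p %| #|G| -> 0 < logn p #|G|.
Proof. by move=> pG; rewrite logn_gt0 mem_primes p_pr cardG_gt0. Qed.

Lemma divp_partn G : p %| #|G| -> #|G| %/ p = #|G|`_p^' * p ^ (logn p #|G|).-1.
Proof.
move=> pG; rewrite -{1}(partnC p (cardG_gt0 G)) p_part.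
by rewrite -{1}(prednK (logn_card_gt0 pG)) expnS -mulnA mulKn ?prime_gt0 // mulnC.
Qed.

Lemma mem_Ldiv_divp G x : p %| #|G| ->
  (x \in 'Ldiv_(#|G| %/ p)(G)) = (x \in G) && (logn p #[x] < logn p #|G|).
Proof.
move=> pG; have k_gt0 := logn_card_gt0 pG.
by rewrite divp_partn // mem_Ldiv_logn -ltnS prednK.
Qed.

(** These are the elements whose p-part generates a Sylow p-subgroup of [G]. *)
Definition maxp_elts G := [set x in G | logn p #[x] == logn p #|G|].

Lemma card_maxp_elts G : p %| #|G| ->
  #|maxp_elts G| + #|'Ldiv_(#|G| %/ p)(G)| = #|G|.
Proof.
move=> pG; rewrite -[RHS](cardsID 'Ldiv_(#|G| %/ p)(G) G) addnC; congr (_ + _).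
  by apply: eq_card => x; rewrite !inE andbA andbb.
apply: eq_card => x; rewrite in_setD mem_Ldiv_divp // [LHS]inE andbC.
have [Gx | ] //= := boolP (x \in G); last by rewrite andbF.
by rewrite -leqNgt eqn_leq dvdn_leq_log ?cardG_gt0 ?order_dvdG ?andbT.
Qed.

Lemma card_maxp_elts_le G : p %| #|G| -> #|maxp_elts G| <= p.-1 * (#|G| %/ p).
Proof.
move=> pG; have := card_maxp_elts pG.
have : #|G| %/ p <= #|'Ldiv_(#|G| %/ p)(G)|.
  apply: dvdn_leq; last by apply/Frobenius_Ldiv/dvdn_div.
  by apply/card_gt0P; exists 1%g; apply/LdivP; rewrite group1 expg1n.
have := divnK pG; have := prime_gt0 p_pr; case: p => //= q _; lia.
Qed.

Lemma maxp_elts_sub_cent G : p %| #|G| ->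
  maxp_elts G \subset
    \bigcup_(S in 'Syl_p(G) | cyclic S) maxp_elts 'C_G(S).
Proof.
move=> pG; apply/subsetP=> x; rewrite inE => /andP[Gx /eqP xk].
have sSG : <[x.`_p]> \subset G by rewrite cycle_subG groupX.
have cardS : #|<[x.`_p]>%g| = #|G|`_p.
  by rewrite -orderE order_constt !p_part xk.
have sylS : p.-Sylow(G) <[x.`_p]> by rewrite pHallE sSG cardS eqxx.
apply/bigcupP; exists <[x.`_p]>%G; first by rewrite inE sylS cycle_cyclic.
have Cx : x \in 'C_G(<[x.`_p]>).
  by rewrite inE Gx cent_cycle; apply/cent1P; apply: commuteX.
rewrite inE Cx eqn_leq dvdn_leq_log ?cardG_gt0 ?order_dvdG //= xk.
by rewrite dvdn_leq_log ?cardG_gt0 ?cardSg ?subsetIl.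
Qed.

(** A noncyclic [P] leaves [maxp_elts G] empty. Otherwise, with [N] and [C] the normalizer and
    centralizer of [P] in [G], each of the [|G : N|] Sylow subgroups accounts for at most
    [p.-1 * (|C| / p)] such elements, and [|N : C| >= 2] makes the total at most half of
    [p.-1 * (|G| / p)]. *)
Lemma card_Ldiv_divp_gt G P : p %| #|G| -> p.-Sylow(G) P ->
    ~~ (cyclic P && ('N_G(P) \subset 'C(P))) ->
  #|G| %/ p + p.-1 <= #|'Ldiv_(#|G| %/ p)(G)|.
Proof.
move=> pG sylP badP; have p_gt1 := prime_gt1 p_pr.
suffices : #|maxp_elts G| <= p.-1 * (#|G| %/ p).-1.
  have := card_maxp_elts pG; have := divnK pG.
  have : 0 < #|G| %/ p by rewrite divn_gt0 ?prime_gt0 // dvdn_leq.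
  case: (#|G| %/ p) => // q _; case: p p_gt1 => //= r _; nia.
have [cycP | ncycP] := boolP (cyclic P); last first.
  suffices -> : maxp_elts G = set0 by rewrite cards0.
  apply/eqP; rewrite -subset0; apply: subset_trans (maxp_elts_sub_cent pG) _.
  apply/bigcupsP=> S /andP[]; rewrite inE => sylS cycS.
  have [x _ defP] := Sylow_trans sylS sylP.
  by rewrite defP cyclicJ cycS in ncycP.
have := subset_leq_card (maxp_elts_sub_cent pG); move/leq_trans; apply.
have sPG := pHall_sub sylP.
have sCN : 'C_G(P) \subset 'N_G(P) by rewrite setIS ?cent_sub.
have pC : p %| #|'C_G(P)|.
  apply: dvdn_trans (cardSg (_ : P \subset _)); last first.
    by rewrite subsetI sPG; apply: cyclic_abelian.
  by rewrite (card_Hall sylP) p_part dvdn_exp ?logn_gt0 ?mem_primes ?p_pr ?cardG_gt0.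
have leS S : S \in 'Syl_p(G) -> #|maxp_elts 'C_G(S)| <= p.-1 * (#|'C_G(P)| %/ p).
  rewrite inE => sylS; have [x Gx defS] := Sylow_trans sylP sylS.
  have cardC : #|'C_G(S)| = #|'C_G(P)|.
    by rewrite defS centJ -{1}(conjGid Gx) -conjIg cardJg.
  by rewrite -cardC card_maxp_elts_le ?cardC.
apply: (@leq_trans (#|G : 'N_G(P)| * (p.-1 * (#|'C_G(P)| %/ p)))).
  rewrite -(card_Syl sylP) -sum_nat_const big_mkcondr /=.
  elim/big_ind2: _ => [|A m B n leAm leBn|S SylS]; first by rewrite cards0.
    by apply: leq_trans (leq_add leAm leBn); rewrite cardsU leq_subr.
  by case: ifP; rewrite ?cards0 ?leS.
have idx_gt1 : 1 < #|'N_G(P) : 'C_G(P)|.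
  rewrite indexg_gt1; apply: contra badP => sNC; rewrite cycP.
  by apply: subset_trans sNC (subsetIr _ _).
have cN : #|G| = #|'C_G(P)| * #|'N_G(P) : 'C_G(P)| * #|G : 'N_G(P)|.
  by rewrite !Lagrange ?subsetIl.
have -> : #|G| %/ p = #|'C_G(P)| %/ p * #|'N_G(P) : 'C_G(P)| * #|G : 'N_G(P)|.
  by rewrite cN -{1}(divnK pC) -!(mulnAC _ _ p) mulnK ?prime_gt0.
have : 0 < #|G : 'N_G(P)| := indexg_gt0 _ _.
have : 0 < #|'C_G(P)| %/ p by rewrite divn_gt0 ?prime_gt0 // dvdn_leq ?cardG_gt0.
move: (_ %/ p) #|G : _| #|_ : 'C_G(P)| idx_gt1 => c r s s_gt1 c_gt0 r_gt0.
rewrite mulnCA leq_mul2l; apply/orP; right.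
have : r * c * 2 <= c * s * r by rewrite (mulnC r) (mulnAC c s) leq_mul2l s_gt1 orbT.
by have : 0 < r * c; [rewrite muln_gt0 r_gt0 | lia].
Qed.

(** * Frobenius counts and the total weight *)

Definition nLdiv G i := #|'Ldiv_(#|G|`_p^' * p ^ i)(G)|.

Lemma dvd_nLdiv G i : i <= logn p #|G| -> #|G|`_p^' * p ^ i %| nLdiv G i.
Proof.
move=> le_ik; apply: Frobenius_Ldiv.
by rewrite -{2}(partnC p (cardG_gt0 G)) mulnC dvdn_mul // p_part dvdn_exp2l.
Qed.

Lemma nLdiv_gt0 G i : 0 < nLdiv G i.
Proof. by apply/card_gt0P; exists 1%g; apply/LdivP; rewrite group1 expg1n. Qed.

Lemma nLdiv_ge G i : i <= logn p #|G| -> #|G|`_p^' * p ^ i <= nLdiv G i.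
Proof. by move=> le_ik; rewrite dvdn_leq ?nLdiv_gt0 ?dvd_nLdiv. Qed.

Lemma sum_logn_gt G i :
  \sum_(x in G) (i < logn p #[x]) + nLdiv G i = #|G|.
Proof.
rewrite -[RHS]sum1_card /nLdiv -sum1_card.
under [X in _ + X]eq_bigl do rewrite mem_Ldiv_logn.
rewrite big_mkcondr -big_split; apply: eq_bigr => x _.
by rewrite /= ltnNge; case: (_ <= i).
Qed.

(** Layer counting: [logn p #[x]] is the number of [i] strictly below it, and [nLdiv G i] counts the
    [x] that miss layer [i]. *)
Lemma sum_logn G :
  \sum_(x in G) logn p #[x] + \sum_(i < logn p #|G|) nLdiv G i
    = logn p #|G| * #|G|.
Proof.
have -> : logn p #|G| * #|G| = \sum_(i < logn p #|G|) #|G|.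
  by rewrite sum_nat_const card_ord.
under [RHS]eq_bigr => i _ do rewrite -(sum_logn_gt G i).
rewrite big_split exchange_big; congr (_ + _); apply: eq_bigr => x Gx /=.
have le_xG : logn p #[x] <= logn p #|G| by rewrite dvdn_leq_log ?order_dvdG.
rewrite -{1}[logn p _]card_ord -sum1_card (big_ord_widen _ (fun=> 1) le_xG) /=.
by rewrite big_mkcond; apply: eq_bigr => i _; case: (_ < _).
Qed.

Lemma expn_sum k : p.-1 * \sum_(i < k) p ^ i + 1 = p ^ k.
Proof. by rewrite -predn_exp addn1 prednK // expn_gt0 prime_gt0. Qed.

(* The class function p.-1 * (v_p(o(x)) + [p | o(x)] / p.-1): over a cyclic group
   its mean is p.-1 times v_p of the order. *)
Definition weight (x : gT) := p.-1 * logn p #[x] + (0 < logn p #[x]).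

(* The deficit of the left-hand side is measured by the excess of each
   [nLdiv G i] over Frobenius' lower bound. *)
Lemma weight_deficit G :
  let k := logn p #|G| in let m := #|G|`_p^' in
  \sum_(x in G) weight x
    + (p.-1 * \sum_(i < k) (nLdiv G i - m * p ^ i) + (nLdiv G 0 - m))
  = p.-1 * (k * #|G|).
Proof.
move=> k m; rewrite big_split -big_distrr -sum_logn -/k mulnDr /=.
have -> : \sum_(i < k) nLdiv G i
    = \sum_(i < k) (nLdiv G i - m * p ^ i) + m * \sum_(i < k) p ^ i.
  rewrite big_distrr -big_split; apply: eq_bigr => i _ /=.
  by rewrite subnK // nLdiv_ge // ltnW.
have := sum_logn_gt G 0; have : m <= nLdiv G 0.
  by have := @nLdiv_ge G 0 isT; rewrite muln1.
have -> : #|G| = m * p ^ k by rewrite mulnC -p_part partnC.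
(* Frobenius' lower bounds contribute [p.-1 * m * a + m = m * p ^ k], which is [|G|], so only the
   excesses survive. *)
have := expn_sum k; move: (\sum_(i < k) p ^ i) (\sum_(x in G) (0 < _)) => a b.
move: (\sum_(i < k) _) => c <-; nia.
Qed.

(** The upper bound from the transfer makes every excess in [weight_deficit] vanish. *)
Lemma weight_central_Sylow G P : p.-Sylow(G) P -> cyclic P ->
    'N_G(P) \subset 'C(P) ->
  \sum_(x in G) weight x = p.-1 * (logn p #|G| * #|G|).
Proof.
move=> sylP cycP cNP; rewrite -(weight_deficit G) -[LHS]addn0; congr (_ + _).
have leL i : nLdiv G i <= #|G|`_p^' * p ^ i.
  apply: (card_Ldiv_central_Sylow sylP (cyclic_abelian cycP) cNP cycP).
  by rewrite expn_gt0 prime_gt0.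
have := leL 0; rewrite muln1 -subn_eq0 => /eqP->.
rewrite big1 ?muln0 // => i _; apply/eqP; rewrite subn_eq0; exact: leL.
Qed.

Lemma weight_gap G P : p.-Sylow(G) P ->
    ~~ (cyclic P && ('N_G(P) \subset 'C(P))) ->
  \sum_(x in G) weight x + p.-1 * p <= p.-1 * (logn p #|G| * #|G|).
Proof.
move=> sylP badP; have p_gt1 := prime_gt1 p_pr.
(* Otherwise [P] is trivial, hence cyclic and central in its normalizer. *)
have pG : p %| #|G|.
  apply: contraR badP => p'G; have /card1_trivg-> : #|P| = 1%N.
    rewrite (card_Hall sylP); apply/eqP; rewrite p_part_eq1.
    by apply: contra p'G; rewrite mem_primes => /and3P[].
  by rewrite cyclic1 cent1T subsetT.
have k_gt0 := logn_card_gt0 pG.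
have := card_Ldiv_divp_gt pG sylP badP.
rewrite (divp_partn pG) -/(nLdiv _ _); set k := logn p #|G|; set m := #|G|`_p^' => ltL.
rewrite -(weight_deficit G) leq_add2l -/k -/m.
(* For k > 1 the excess is a nonzero multiple of m * p ^ k.-1, hence of p. *)
have [k1 | k_neq1] := eqVneq k 1%N.
  (* The excess of [nLdiv G 0] now enters both terms of the deficit, with total coefficient
     [p.-1 + 1 = p]. *)
  by move: ltL; rewrite k1 big_ord1 /= expn0 !muln1; nia.
have k1_gt0 : 0 < k.-1 by rewrite -subn1 subn_gt0 ltn_neqAle eq_sym k_neq1.
have lt_k1 : k.-1 < k by rewrite prednK.
apply: leq_trans (leq_addr _ _); rewrite leq_mul2l; apply/orP; right.
rewrite (bigD1 (Ordinal lt_k1)) //=; apply: leq_trans (leq_addr _ _).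
have q_gt0 : 0 < m * p ^ k.-1 by rewrite muln_gt0 part_gt0 expn_gt0 prime_gt0.
have p_dvd : p %| m * p ^ k.-1 by rewrite dvdn_mull // dvdn_exp.
rewrite dvdn_leq ?subn_gt0 //; first by lia.
by rewrite dvdn_sub // (dvdn_trans p_dvd) // dvd_nLdiv // ltnW.
Qed.

End Counting.

(** * Pairing the Artin relation with class functions *)

Local Open Scope ring_scope.

(** Frobenius reciprocity for the trivial character of [H], with the normalizing factors cleared. *)
Lemma sum_Ind1 (gT : finGroupType) (G H : {group gT}) (f : gT -> algC) :
    H \subset G -> {in G &, forall x y, f (x ^ y)%g = f x} ->
  \sum_(x in G) f x * 'Ind[G, H] 1 x = #|G|%:R / #|H|%:R * \sum_(x in H) f x.
Proof.
move=> sHG fJ.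
have fG y : y \in G -> \sum_(x in G) f x * (1 : 'CF(H)) (x ^ y)%g = \sum_(x in H) f x.
  move=> Gy; rewrite (reindex_acts 'J _ (groupVr Gy)) /=; last first.
    by rewrite astabsJ normG.
  rewrite [RHS]big_mkcond [LHS]big_mkcond; apply: eq_bigr => x _ /=.
  rewrite conjgKV cfun1E; case: (boolP (x \in H)) => Hx; rewrite ?mulr0 ?if_same //.
  by rewrite (subsetP sHG) // mulr1 fJ ?groupV // (subsetP sHG).
under eq_bigr do rewrite cfIndE // mulrCA mulr_sumr.
rewrite -mulr_sumr exchange_big (eq_bigr _ fG) sumr_const.
by rewrite -[_ *+ #|G|]mulr_natl mulrA (mulrC _^-1).
Qed.

Lemma artin_coeffs_mean (gT : finGroupType) (G : {group gT})
    (R : {set {group gT}}) (alpha : {group gT} -> rat) (f : gT -> rat) :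
    (forall K : {group gT}, K \in R -> K \subset G) -> artin_coeffs G R alpha ->
    {in G &, forall x y, f (x ^ y)%g = f x} ->
  \sum_(x in G) f x
    = #|G|%:R * \sum_(H in R) alpha H * (#|H|%:R^-1 * \sum_(x in H) f x).
Proof.
move=> sRG artin fJ; apply: (fmorph_inj (ratr : {rmorphism rat -> algC})).
have gJ : {in G &, forall x y, ratr (f (x ^ y)%g) = ratr (f x) :> algC}.
  by move=> x y Gx Gy; rewrite /= fJ.
transitivity (\sum_(x in G) ratr (f x) * (1 : 'CF(G)) x : algC).
  by rewrite rmorph_sum; apply: eq_bigr => x Gx; rewrite cfun1E Gx mulr1.
under eq_bigr do rewrite {1}artin sum_cfunE mulr_sumr.
rewrite exchange_big rmorphM rmorph_sum mulr_sumr rmorph_nat.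
apply: eq_bigr => H RH; under eq_bigr do rewrite cfunE mulrCA.
rewrite -mulr_sumr (sum_Ind1 (sRG H RH) gJ).
rewrite !rmorphM rmorph_sum fmorphV rmorph_nat; ring.
Qed.

(** Each [H] in [R] is cyclic, so [weight_central_Sylow] gives its mean weight as
    [p.-1 * logn p #|H|]; the term [[G]] of the relation accounts for the added [logn p #|G|]. *)
Lemma weight_regconst (gT : finGroupType) (G : {group gT}) (p : nat)
    (R : {set {group gT}}) (alpha : {group gT} -> rat) :
    prime p -> cyclic_class_reps G R -> artin_coeffs G R alpha ->
  (\sum_(x in G) weight p x)%:R = p.-1%:R * #|G|%:R *
    (vp_regconst_trivial p (artin_relation G R alpha) + (logn p #|G|)%:R) :> rat.
Proof.
move=> p_pr [cycR _ _] artin.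
have sRG K : K \in R -> K \subset G by case/cycR.
rewrite natr_sum (artin_coeffs_mean sRG artin); last first.
  by move=> x y _ _; rewrite /weight orderJ.
rewrite /vp_regconst_trivial big_cons big_map big_enum /= mulN1r addrAC addNr add0r.
rewrite -mulrA mulrCA; congr (_ * _); rewrite mulr_sumr; apply: eq_bigr => H RH.
have [sHG cycH] := cycR H RH.
have [P sylP] := Sylow_exists p H.
rewrite -natr_sum (weight_central_Sylow p_pr sylP); first last.
- apply: subset_trans (subsetIl _ _) _.
  exact: subset_trans (cyclic_abelian cycH) (centS (pHall_sub sylP)).
- exact: cyclicS (pHall_sub sylP) cycH.
rewrite opprK !natrM; field.
by rewrite pnatr_eq0 -lt0n cardG_gt0.
Qed.

Theorem theorem1p2 (gT : finGroupType) (G : {group gT}) (p : nat)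
    (R : {set {group gT}}) (alpha : {group gT} -> rat) :
  prime p ->
  cyclic_class_reps G R ->
  artin_coeffs G R alpha ->
  let v := vp_regconst_trivial p (artin_relation G R alpha) in
  (v != 0 <-> exists2 H : {group gT}, H \subset G & p_hypo_elementary p H /\ ~~ cyclic H)
  /\ ((exists2 H : {group gT}, H \subset G & p_hypo_elementary p H /\ ~~ cyclic H) ->
      v <= - (p%:R / #|G|%:R)).
Proof.
move=> p_pr repsR artin v; have p_gt1 := prime_gt1 p_pr.
have p1_gt0 : (0 : rat) < p.-1%:R by rewrite ltr0n -subn1 subn_gt0.
have G_gt0 : (0 : rat) < #|G|%:R by rewrite ltr0n cardG_gt0.
have [P sylP] := Sylow_exists p G.
have := weight_regconst p_pr repsR artin; rewrite -/v => sum_w.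
have [/andP[cycP cNP] | badP] := boolP (cyclic P && ('N_G(P)%g \subset 'C(P)%g)).
  have noH : ~ exists2 H : {group gT}, H \subset G & p_hypo_elementary p H /\ ~~ cyclic H.
    case=> H sHG [hypoH]; apply/negP; rewrite negbK.
    exact: (central_Sylow_hypo_elementary sylP (cyclic_abelian cycP) cNP cycP sHG hypoH).
  have v0 : v = 0.
    move: sum_w; rewrite (weight_central_Sylow p_pr sylP cycP cNP) !natrM.
    have nz : p.-1%:R * #|G|%:R != 0 :> rat by rewrite mulf_neq0 ?gt_eqF.
    rewrite [_ * #|G|%:R]mulrC mulrA => /(mulfI nz)/eqP.
    by rewrite -subr_eq0 opprD addrCA subrr addr0 oppr_eq0 => /eqP.
  by split=> [|/noH//]; split=> [|/noH//]; rewrite v0 eqxx.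
have existsH := noncyclic_hypo_elementary_exists sylP badP.
have le_v : v <= - (p%:R / #|G|%:R).
  (* Cancelling [p.-1] from the gap inequality leaves [|G| * v + p <= 0]. *)
  have := weight_gap p_pr sylP badP; rewrite -(ler_nat rat) natrD sum_w !natrM.
  rewrite -mulrA -mulrDr ler_pM2l // mulrDr mulrC -subr_ge0.
  rewrite -mulNr ler_pdivlMr //; lra.
split=> //; split=> // _; rewrite lt_eqF // (le_lt_trans le_v) //.
by rewrite oppr_lt0 divr_gt0 // ltr0n prime_gt0.
Qed.
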